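(* For every set $I$, the operations $\mathbb{R}^I\to\mathbb{R}$ that preserve integrability are exactly those generated by the operations $0$, $+$, $\lor$, $\lambda(\,\cdot\,)$ (for each $\lambda\in\mathbb{R}$), $\curlyvee$ and $\overline{\,\cdot\,}$.
   Context: The listed operations on $\mathbb{R}$ are: the constant $0$ (arity $0$), addition, binary supremum $\lor$, multiplication by the scalar $\lambda$, the operation of countably infinite arity $\curlyvee(y,x_0,x_1,\dots)=\sup_{n\in\omega}\{x_n\land y\}$ (with $\omega=\{0,1,2,\dots\}$), and the unary operation $\overline{x}=x\land 1$ (truncation). Generation: for sets $\Omega,K$, a function $\tau\colon\mathbb{R}^K\to\mathbb{R}$ and $S\subseteq\mathbb{R}^\Omega$, $S$ is closed under $\tau$ if for every family $(f_i)_{i\in K}$ of elements of $S$ the function $\tau((f_i)_{i\in K})\colon x\mapsto\tau((f_i(x))_{i\in K})$ belongs to $S$. Given a set $\mathcal{C}$ of operations on $\mathbb{R}$ (of possibly different arities), a function $f\colon\mathbb{R}^I\to\mathbb{R}$ is generated by $\mathcal{C}$ if it belongs to the smallest subset of $\mathbb{R}^{\mathbb{R}^I}$ that contains all projections $\pi_i\colon\mathbb{R}^I\to\mathbb{R}$ ($i\in I$) and is closed under each element of $\mathcal{C}$. Preservation: for $p\in[1,+\infty)$ and a measure space $(\Omega,\mathcal{F},\mu)$ (with $\mu$ valued in $[0,+\infty]$), $\mathcal{L}^p(\mu)$ is the set of $\mathcal{F}$-measurable $f\colon\Omega\to\mathbb{R}$ with $\int_\Omega|f|^p\,d\mu<\infty$.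 A function $\tau\colon\mathbb{R}^I\to\mathbb{R}$ preserves $p$-integrability if, for every measure space $(\Omega,\mathcal{F},\mu)$, $\mathcal{L}^p(\mu)$ is closed under $\tau$. This condition does not depend on $p\in[1,+\infty)$, and $\tau$ is said to preserve integrability if it holds for some (equivalently, every) $p\in[1,+\infty)$. *)

(* Defs.v *)
From mathcomp Require Import all_boot all_order all_algebra.
From mathcomp Require Import all_classical all_reals all_analysis.

Set Implicit Arguments.
Unset Strict Implicit.
Unset Printing Implicit Defensive.
Import Order.TTheory GRing.Theory Num.Theory.

Local Open Scope classical_set_scope.
Local Open Scope ring_scope.

Record operation (R : Type) := Operation {
  arity : Type;
  op_fun : (arity -> R) -> R }.

Definition closed_under (R Omega K : Type) (tau : (K -> R) -> R)
    (S : set (Omega -> R)) : Prop :=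
  forall f : K -> Omega -> R, (forall i, S (f i)) ->
    S (fun x => tau (fun i => f i x)).

Definition proj (R I : Type) (i : I) : (I -> R) -> R := fun x => x i.

Definition generated (R : Type) (C : set (operation R)) (I : Type) :
    set ((I -> R) -> R) :=
  smallest [set S | forall o, C o -> closed_under (@op_fun R o) S]
           (range (@proj R I)).
Arguments generated {R} C I.

Section listed_operations.
Variable R : realType.

Definition op_zero : operation R :=
  @Operation R void (fun=> 0).

Definition op_add : operation R :=
  @Operation R bool (fun x => x false + x true).

Definition op_join : operation R :=
  @Operation R bool (fun x => Num.max (x false) (x true)).

Definition op_scale (lambda : R) : operation R :=
  @Operation R unit (fun x => lambda * x tt).

(* The argument y is indexed by [None] and x_n by [Some n]; the set whose [sup]
   is taken is nonempty and bounded above by y. *)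
Definition op_curlyvee : operation R :=
  @Operation R (option nat)
    (fun x => sup (range (fun n => Num.min (x (Some n)) (x None)))).

Definition op_trunc : operation R :=
  @Operation R unit (fun x => Num.min (x tt) 1).

Definition listed_operations : set (operation R) :=
  [set op_zero; op_add; op_join; op_curlyvee; op_trunc] `|` range op_scale.

(* Carriers of [measurableType] are pointed; the only measure space this leaves
   out is the empty one, whose L^p is all of R^Omega and hence closed under
   every tau. *)
Definition preserves_integrability (p : R) (I : Type)
    (tau : (I -> R) -> R) : Prop :=
  forall (d : measure_display) (Omega : measurableType d)
         (mu : {measure set Omega -> \bar R}),
    closed_under tau [set f : Omega -> R | f \in Lfun mu p%:E].

End listed_operations.
Arguments listed_operations R : clear implicits.

(* Main.v *)
(** For the zero measure on [I -> R], [L^p] consists of all measurable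
    functions, so preservation of [p]-integrability makes [tau] measurable for
    the cylinder sigma-algebra; hence [tau] depends on countably many
    coordinates [e 0, e 1, ...].  If no constant and no finite set of these
    coordinates gave a bound [|tau v| <= C * \sum_k |v (e k)|], vectors [V n]
    violating such bounds ever more strongly, with weights [|tau (V n)|^-p],
    would define a measure on [nat] for which all coordinates are in [L^p] and
    [tau] is not.

    Conversely let [S] be closed under the listed operations and let [tau] be
    measurable for the sigma-algebra generated by [S] and dominated by [g] in
    [S].  Truncation and the countable supremum put the indicator of [a < g] in
    [S] for [a > 0]; if the indicator of [B] is in [S], the sets [A] such that
    the indicator of [A `&` B] is in [S] form a sigma-algebra containing
    [c < f] for all [f] in [S].  So [S] contains the indicator of [q < tau] for
    all rational [q > 0], and the positive part of [tau] is the supremum of the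
    functions [q * \1_(q < tau)], which are bounded by [g]. *)
From HB Require Import structures.
Require Import Defs.
From mathcomp Require Import all_boot all_order all_algebra.
From mathcomp Require Import all_classical all_reals all_analysis.
From mathcomp Require Import measurable_realfun lra.
Import Order.TTheory GRing.Theory Num.Theory.
Local Open Scope classical_set_scope.
Local Open Scope ring_scope.

(** * Suprema of real sequences and values of indicators *)

Lemma sup_range_eq (R : realType) (x : nat -> R) (l : R) :
  (forall n, x n <= l) -> (forall m, m < l -> exists n, m < x n) ->
  sup (range x) = l.
Proof.
move=> xl lx; have ubx : has_ubound (range x) by exists l => _ [n _ <-].
apply/eqP; rewrite eq_le; apply/andP; split.
  by apply: ge_sup => [|_ [n _ <-]]; [exists (x 0%N), 0%N|].
rewrite leNgt; apply/negP => /lx[n]; apply/negP; rewrite -leNgt.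
by apply: ub_le_sup => //; exists n.
Qed.

Lemma sup_range_attained (R : realType) (x : nat -> R) (l : R) (n : nat) :
  (forall k, x k <= l) -> l <= x n -> sup (range x) = l.
Proof.
by move=> xl lx; apply: sup_range_eq => // m ml; exists n; exact: lt_le_trans lx.
Qed.

Lemma exists_natmul_ge1 (R : realType) (d : R) : 0 < d -> exists n, 1 <= n%:R * d.
Proof.
move=> d0; exists (Num.bound d^-1).
rewrite -ler_pdivrMr// div1r ltW//.
by apply: archi_boundP; rewrite invr_ge0 ltW.
Qed.

Lemma indic_set_gt (R : realType) (T : Type) (f : T -> R) (a : R) (x : T) :
  \1_[set y | a < f y] x = (a < f x)%R%:R :> R.
Proof.
by rewrite indicE; congr (nat_of_bool _)%:R; apply/idP/idP; rewrite inE.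
Qed.

Lemma indic_setI (R : realType) (T : Type) (A B : set T) (x : T) :
  \1_(A `&` B) x = \1_A x * \1_B x :> R.
Proof. by rewrite indicI. Qed.

(** Generators of the smallest sigma-algebra for which every member of [S] is measurable. *)
Definition rays {R : realType} {T : Type} (S : set (T -> R)) : set (set T) :=
  [set A | exists2 f, S f & exists c, A = [set x | c < f x]].

(** * Sets of functions closed under the listed operations *)

Section closed_under_listed.
Context {R : realType} {T : Type} {S : set (T -> R)}.
Hypothesis S_closed :
  forall o, listed_operations R o -> closed_under (@op_fun R o) S.

Lemma closed_zero : S (fun=> 0).
Proof.
apply: (S_closed (op_zero R) _ (fun=> (fun=> 0))) => [|[]].
by left; do 4 left.
Qed.

Lemma closed_add {f g : T -> R} : S f -> S g -> S (fun x => f x + g x).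
Proof.
move=> Sf Sg.
apply: (S_closed (op_add R) _ (fun b => if b then g else f)) => [|[]//].
by left; do 3 left; right.
Qed.

Lemma closed_max {f g : T -> R} :
  S f -> S g -> S (fun x => Num.max (f x) (g x)).
Proof.
move=> Sf Sg.
apply: (S_closed (op_join R) _ (fun b => if b then g else f)) => [|[]//].
by left; do 2 left; right.
Qed.

Lemma closed_scale (a : R) {f : T -> R} : S f -> S (fun x => a * f x).
Proof.
move=> Sf; apply: (S_closed (op_scale a) _ (fun=> f)) => [|//].
by right; exists a.
Qed.

Lemma closed_trunc {f : T -> R} : S f -> S (fun x => Num.min (f x) 1).
Proof.
by move=> Sf; apply: (S_closed (op_trunc R) _ (fun=> f)) => [|//]; left; right.
Qed.

Lemma closed_curlyvee {f : nat -> T -> R} {g : T -> R} :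
  (forall n, S (f n)) -> S g ->
  S (fun x => sup (range (fun n => Num.min (f n x) (g x)))).
Proof.
move=> Sf Sg.
apply: (S_closed (op_curlyvee R) _ (fun o => if o is Some n then f n else g)).
  by left; left; right.
by case.
Qed.

Lemma closed_opp {f : T -> R} : S f -> S (fun x => - f x).
Proof.
by move=> /(closed_scale (- 1)); under eq_fun do rewrite mulN1r.
Qed.

Lemma closed_sub {f g : T -> R} : S f -> S g -> S (fun x => f x - g x).
Proof. by move=> Sf Sg; apply: closed_add => //; exact: closed_opp. Qed.

Lemma closed_abs {f : T -> R} : S f -> S (fun x => `|f x|).
Proof.
move=> Sf; under eq_fun => x.
  rewrite (_ : `|f x| = Num.max (f x) (- f x)); last first.
    by case: (ler0P (f x)) => f0; case: leP => //; lra.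
  over.
by apply: closed_max => //; exact: closed_opp.
Qed.

Lemma closed_sum (f : nat -> T -> R) (n : nat) :
  (forall k, S (f k)) -> S (fun x => \sum_(k < n) f k x).
Proof.
move=> Sf; elim: n => [|n IHn].
  by under eq_fun do rewrite big_ord0; exact: closed_zero.
by under eq_fun do rewrite big_ord_recr/=; exact: closed_add.
Qed.

(** With [y = g / a], the function [g - a * min y 1] is the positive part of [g - a]; its multiples
    truncated at 1 increase to the indicator. The constant 1 need not lie in [S], so [y] serves as
    the cap of the supremum: it is at least 1 wherever [a < g]. *)
Lemma closed_indic_gt {g : T -> R} {a : R} :
  S g -> (forall x, 0 <= g x) -> 0 < a -> S \1_[set x | a < g x].
Proof.
move=> Sg g0 a0.
pose y x := a^-1 * g x.
pose u n x := Num.min (n%:R * (g x - a * Num.min (y x) 1)) 1.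
have Sy : S y by exact: closed_scale.
have Su n : S (u n).
  by apply/closed_trunc/closed_scale/closed_sub => //; exact/closed_scale/closed_trunc.
suff -> : \1_[set x | a < g x] =
    fun x => sup (range (fun n => Num.min (u n x) (y x))).
  exact: closed_curlyvee.
apply/funext => x; rewrite indic_set_gt; apply/esym.
have y0 : 0 <= y x by rewrite mulr_ge0// invr_ge0 ltW.
have [ag|ga] := ltP a (g x).
  have y1 : 1 <= y x by rewrite ler_pdivlMl// mulr1 ltW.
  have [n n1] : exists n, 1 <= n%:R * (g x - a).
    by apply: exists_natmul_ge1; rewrite subr_gt0.
  apply: (@sup_range_attained _ _ _ n) => [k|].
    by rewrite !ge_min lexx orbT.
  by rewrite /u (min_r y1) mulr1 !le_min lexx n1 y1.
have y1 : y x <= 1 by rewrite ler_pdivrMl// mulr1.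
have u0 n : u n x = 0.
  by rewrite /u (min_l y1) /y mulVKf ?gt_eqF// subrr mulr0 min_l.
by apply: (@sup_range_attained _ _ _ 0%N) => [k|]; rewrite u0 min_l.
Qed.

(** On [B] the indicator of [B] replaces the constants 1 and [c * \1_B] replaces [c], so multiples
    of the positive part of [f - c] capped by [\1_B] reach the indicator. Off [B] the cap 0 makes
    every term vanish, whatever the sign of [c]. *)
Lemma closed_indic_ray {f : T -> R} {B : set T} (c : R) :
  S f -> S \1_B -> S \1_([set x | c < f x] `&` B).
Proof.
move=> Sf SB.
pose u n x := n%:R * Num.max (f x - c * \1_B x) 0.
have Su n : S (u n).
  apply/closed_scale/closed_max; last exact: closed_zero.
  by apply/closed_sub => //; exact: closed_scale.
suff -> : \1_([set x | c < f x] `&` B) =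
    fun x => sup (range (fun n => Num.min (u n x) (\1_B x))).
  exact: closed_curlyvee.
apply/funext => x; rewrite indic_setI indic_set_gt; apply/esym.
have u0 n : 0 <= u n x by rewrite mulr_ge0// le_max lexx orbT.
rewrite /u indicE; case: (x \in B) => /=; last first.
  rewrite !mulr0 subr0.
  apply: (@sup_range_attained _ _ _ 0%N) => [k|]; first by rewrite ge_min lexx orbT.
  by rewrite mul0r minxx.
rewrite !mulr1; have [cf|fc] := ltP c (f x).
  have [n n1] : exists n, 1 <= n%:R * (f x - c).
    by apply: exists_natmul_ge1; rewrite subr_gt0.
  apply: (@sup_range_attained _ _ _ n) => [k|]; first by rewrite ge_min lexx orbT.
  by rewrite max_l ?le_min ?n1 ?lexx// subr_ge0 ltW.
rewrite max_r ?subr_le0//.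
by apply: (@sup_range_attained _ _ _ 0%N) => [k|]; rewrite mulr0 min_l.
Qed.

Lemma closed_indic_sigma {A B : set T} :
  S \1_B -> <<s rays S >> A -> S \1_(A `&` B).
Proof.
move=> SB sA.
suff : <<s rays S >> `<=` [set A | S \1_(A `&` B)] by apply.
apply: smallest_sub => [|_ [f Sf [c ->]]]; last exact: closed_indic_ray.
split => [|C SC|F SF] /=.
- rewrite set0I indic0; exact: closed_zero.
- rewrite setTD (_ : \1_ _ = fun x => \1_B x - \1_(C `&` B) x); first exact: closed_sub.
  apply/funext => x; rewrite !indic_setI !indicE in_setC.
  by case: (x \in C); rewrite ?mul1r ?mul0r ?subrr ?subr0.
rewrite (_ : \1_ _ = fun x =>
    sup (range (fun n => Num.min (\1_(F n `&` B) x) (\1_B x)))).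
  exact: closed_curlyvee.
apply/funext => x; rewrite indic_setI; apply/esym.
under eq_fun do rewrite indic_setI.
rewrite !indicE; case: (x \in B) => /=; last first.
  by apply: (@sup_range_attained _ _ _ 0%N) => [k|]; rewrite !mulr0 minxx.
rewrite [RHS]mulr1; have [[n _ Fnx]|nF] := pselect ((\bigcup_n F n) x).
  rewrite mem_set; last by exists n.
  apply: (@sup_range_attained _ _ _ n) => [k|]; first by rewrite ge_min lexx orbT.
  by rewrite indicE mem_set// mulr1 minxx.
have F0 k : \1_(F k) x = 0 :> R.
  by rewrite indicE memNset// => Fkx; apply: nF; exists k.
rewrite memNset//.
by apply: (@sup_range_attained _ _ _ 0%N) => [k|]; rewrite F0 mul0r min_l.
Qed.

Lemma closed_posfun {f g : T -> R} :
  (forall c, <<s rays S >> [set x | c < f x]) ->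
  S g -> (forall x, 0 <= g x) -> (forall x, f x <= g x) ->
  S (fun x => Num.max (f x) 0).
Proof.
move=> mf Sg g0 fg.
(* An enumeration of the rationals; the default 0 at numbers coding no rational is harmless, the
   positive part being nonnegative. *)
pose u (n : nat) x : R := if unpickle n is Some q
  then Num.max (ratr q) 0 * \1_[set x | ratr q < f x] x else 0.
have Su n : S (u n).
  rewrite /u; case: unpickle => [q|]; last exact: closed_zero.
  have [q0|q0] := leP (ratr q : R) 0.
    by under eq_fun do rewrite mul0r; exact: closed_zero.
  apply: closed_scale.
  (* Since [f <= g], the intersection changes nothing, and as [q > 0] the indicator of the second
     set is already in [S]. *)
  rewrite (_ : [set _ | _] = [set x | ratr q < f x] `&` [set x | ratr q < g x]).
    by apply: closed_indic_sigma => //; exact: closed_indic_gt.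
  apply/seteqP; split => [x qf|x []//]; split => //.
  exact: lt_le_trans (fg x).
suff -> : (fun x => Num.max (f x) 0) =
    fun x => sup (range (fun n => Num.min (u n x) (g x))).
  exact: closed_curlyvee.
apply/funext => x; apply/esym/sup_range_eq => [n|m].
  rewrite ge_min /u; case: unpickle => [q|]; last by rewrite le_max lexx orbT.
  apply/orP; left; rewrite indic_set_gt.
  case: ltP => [qf|_]; last by rewrite mulr0 le_max lexx orbT.
  by rewrite mulr1 ge_max !le_max (ltW qf) lexx orbT.
have [m0|m0] := ltP m 0.
  move=> _; exists 0%N; rewrite lt_min (lt_le_trans m0 (g0 x)) andbT.
  apply: (lt_le_trans m0); rewrite /u; case: unpickle => // q.
  by rewrite mulr_ge0// le_max lexx orbT.
rewrite lt_max [m < 0]ltNge m0 orbF => mf'.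
have [q] := rat_in_itvoo mf'; rewrite in_itv/= => /andP[mq qf].
exists (pickle q); rewrite /u pickleK indic_set_gt qf mulr1 lt_min.
by rewrite lt_max mq (lt_le_trans mf' (fg x)).
Qed.

End closed_under_listed.

Lemma closed_measurable_dominated {R : realType} {T : pointedType}
    {S : set (T -> R)} {f g : T -> R} :
  (forall o, listed_operations R o -> closed_under (@op_fun R o) S) ->
  measurable_fun [set: g_sigma_algebraType (rays S)] f ->
  S g -> (forall x, `|f x| <= g x) -> S f.
Proof.
move=> S_closed mf Sg fg.
have g0 x : 0 <= g x := le_trans (normr_ge0 _) (fg x).
have ray (h : g_sigma_algebraType (rays S) -> R) c :
    measurable_fun setT h -> <<s rays S >> [set x | c < h x].
  move=> mh; rewrite (_ : [set x | c < h x] = setT `&` h @^-1` `]c, +oo[).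
    exact: mh.
  by apply/seteqP; split=> x /=; rewrite in_itv/= andbT; [|case].
have Sp : S (fun x => Num.max (f x) 0).
  apply: (closed_posfun S_closed _ Sg g0) => [c|x]; first exact: ray.
  exact: le_trans (ler_norm _) (fg x).
have Sn : S (fun x => Num.max (- f x) 0).
  apply: (closed_posfun S_closed _ Sg g0) => [c|x].
    by apply: ray; exact: measurable_funN.
  by apply: le_trans (ler_norm _) _; rewrite normrN.
rewrite (_ : f = fun x => Num.max (f x) 0 - Num.max (- f x) 0).
  exact: (closed_sub S_closed Sp Sn).
by apply/funext => x; rewrite /Num.max oppr_lt0; case: ltgtP; lra.
Qed.

(** * Closure of L^p under the listed operations *)

Section Lp.
Context {d : measure_display} {T : measurableType d} {R : realType}.
Context {mu : {measure set T -> \bar R}} {p : R}.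
Hypothesis p1 : 1 <= p.

Lemma mem_LfunP (f : T -> R) : f \in Lfun mu p%:E <->
  measurable_fun setT f /\ (\int[mu]_x (`|f x| `^ p)%:E < +oo)%E.
Proof.
split=> [fL|[mf fi]].
  split.
    by move: fL; rewrite inE => /andP[/[!inE]].
  have /integrableP[_] := Lfun_integrable p1 fL.
  by under eq_integral do rewrite gee0_abs ?lee_fin ?powR_ge0//.
rewrite inE; apply/andP; split; rewrite inE//= /finite_norm unlock.
by rewrite poweR_lty.
Qed.

Lemma Lfun_dominated {f g : T -> R} : measurable_fun setT f ->
  g \in Lfun mu p%:E -> (forall x, `|f x| <= `|g x|) -> f \in Lfun mu p%:E.
Proof.
move=> mf /mem_LfunP[mg gi] fg; apply/mem_LfunP; split => //.
have mpow (h : T -> R) : measurable_fun setT h ->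
    measurable_fun setT (fun x => `|h x| `^ p).
  move=> mh; apply: (measurableT_comp (measurable_powR p)).
  exact: measurableT_comp.
apply: le_lt_trans gi; apply: ge0_le_integral => //.
- by apply/measurable_EFinP; exact: mpow.
- by apply/measurable_EFinP; exact: mpow.
- move=> x _; rewrite lee_fin; apply: ge0_ler_powR; rewrite ?nnegrE//.
  exact: le_trans p1.
Qed.

Lemma closed_Lfun (o : operation R) : listed_operations R o ->
  closed_under (@op_fun R o) [set f : T -> R | f \in Lfun mu p%:E].
Proof.
have LfunD (f g : T -> R) : f \in Lfun mu p%:E -> g \in Lfun mu p%:E ->
    (fun x => f x + g x) \in Lfun mu p%:E.
  move=> fL gL; have p1' : (1 <= p%:E)%E by rewrite lee_fin.
  by have [_] := Lfun_addr_closed mu p1'; exact.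
have Lfun_abs (f : T -> R) : f \in Lfun mu p%:E ->
    (fun x => `|f x|) \in Lfun mu p%:E.
  move=> fL; apply: (Lfun_dominated _ fL) => [|x]; last by rewrite normr_id.
  by have /mem_LfunP[mf _] := fL; exact: measurableT_comp.
have mL (f : T -> R) : f \in Lfun mu p%:E -> measurable_fun setT f.
  by move=> /mem_LfunP[].
case=> [[[[[->|->]|->]|->]|->]|[a _ <-]] f /= fL.
- apply/mem_LfunP; split; first exact: measurable_cst.
  under eq_integral do rewrite normr0 powR0 ?gt_eqF ?(lt_le_trans ltr01)//.
  by rewrite integral0.
- exact: LfunD.
- apply: (Lfun_dominated _ (LfunD _ _ (Lfun_abs _ (fL false)) (Lfun_abs _ (fL true)))).
    by apply: measurable_maxr; exact: mL.
  move=> x; rewrite [leRHS]ger0_norm ?addr_ge0//.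
  by rewrite /Num.max; case: ifP => _; rewrite ?lerDl ?lerDr.
(* The supremum lies between [min x_0 y] and [y], hence is at most [|x_0| + |y|] in absolute
   value. *)
- have ub x : has_ubound
      (range (fun n => Num.min (f (Some n) x) (f None x))).
    by exists (f None x) => _ [n _ <-]; rewrite ge_min lexx orbT.
  apply: (Lfun_dominated _
    (LfunD _ _ (Lfun_abs _ (fL (Some 0%N))) (Lfun_abs _ (fL None)))).
    rewrite (_ : (fun _ => _) = fun x =>
      sups (fun n => Num.min (f (Some n) x) (f None x)) 0%N); last first.
      apply/funext => x; rewrite /sups; congr sup.
      by apply/seteqP; split => _ [n _ <-]; exists n.
    apply: (@measurable_fun_sups _ _ _ _
      (fun n x => Num.min (f (Some n) x) (f None x))) => [x _|n].
      exact: ub.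
    by apply: measurable_minr; exact: mL.
  move=> x; rewrite [leRHS]ger0_norm ?addr_ge0//.
  set s := sup _.
  have sN : s <= f None x.
    apply: ge_sup => [|_ [n _ <-]]; last by rewrite ge_min lexx orbT.
    by exists (Num.min (f (Some 0%N) x) (f None x)), 0%N.
  have s0 : Num.min (f (Some 0%N) x) (f None x) <= s.
    by apply: ub_le_sup => //; exists 0%N.
  have := ler_norm (f None x); have := ler_norm (- f None x).
  have := ler_norm (- f (Some 0%N) x); rewrite !normrN.
  have := normr_ge0 (f (Some 0%N) x); have := normr_ge0 (f None x).
  rewrite ler_norml; move: s0; rewrite /Num.min; case: ifP => _; lra.
- apply: (Lfun_dominated _ (fL tt)).
    by apply: measurable_minr; [exact: mL|exact: measurable_cst].
  move=> x; rewrite /Num.min; case: ltP => // x1.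
  by rewrite normr1 (le_trans x1)// ler_norm.
- rewrite (_ : (fun _ => _) = a \o* f tt); first exact: Lfun_scale.
  by apply/funext => x /=; rewrite mulrC.
Qed.

End Lp.

(** * Weighted counting measures and convergent series *)

Lemma ge0_integral_weighted_dirac (R : realType) (w : nat -> {nonneg R})
    (f : nat -> R) : (forall n, 0 <= f n) ->
  (\int[mseries (fun n => mscale (w n) (\d_n)%R) 0]_x (f x)%:E =
   \sum_(0 <= n <oo) ((w n)%:num * f n)%:E)%E.
Proof.
move=> f0; rewrite ge0_integral_measure_series//; last first.
  by move=> n _; rewrite lee_fin.
apply: eq_eseriesr => n _; rewrite ge0_integral_mscale//; last first.
  by move=> m _; rewrite lee_fin.
by rewrite integral_dirac// diracT mul1e EFinM.
Qed.

Lemma nneseries_half_lty (R : realType) (a : nat -> R) (K : nat) :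
  (forall n, 0 <= a n) -> (forall n, (K <= n)%N -> a n <= (2 ^ n.+1)%:R^-1) ->
  (\sum_(0 <= n <oo) (a n)%:E < +oo)%E.
Proof.
move=> a0 aK; rewrite (nneseries_split 0 K) => [|k _]; last by rewrite lee_fin.
rewrite lte_add_pinfty//; first by rewrite sumEFin ltry.
rewrite add0n ereal_series.
apply: (@le_lt_trans _ _ 1%E); last by rewrite ltry.
apply: le_trans (epsilon_trick0 (fun n => K <= n)%N (@ler01 R)).
apply: lee_nneseries => n; first by rewrite lee_fin.
by move=> Kn; rewrite lee_fin div1r; exact: aK.
Qed.

(** * Measurability and domination of integrability-preserving operations *)

Section preserving.
Context {R : realType} {I : Type}.

(* [R] itself has no canonical [pointedType] structure, but its alias
   [measurableTypeR R] does. *)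
Definition cylinder_space :=
  @g_sigma_algebraType (I -> measurableTypeR R) (rays (range (@Defs.proj R I))).
HB.instance Definition _ := Measurable.on cylinder_space.

Implicit Types (tau : (I -> R) -> R) (e : nat -> option I).

Lemma preserves_measurable {p : R} {tau} : 1 <= p ->
  preserves_integrability p tau ->
  measurable_fun [set: cylinder_space] tau.
Proof.
move=> p1 ptau.
have mzL (f : cylinder_space -> R) :
    f \in Lfun (@mzero _ cylinder_space R) p%:E <-> measurable_fun setT f.
  rewrite mem_LfunP//; split=> [[]//|mf]; split => //.
  by rewrite integral_measure_zero.
apply/mzL; apply: (ptau _ cylinder_space mzero (@Defs.proj R I)) => i /=; apply/mzL.
apply: (measurability _ (RGenOInfty.measurableE R)) => _ [_ [c ->] <-].
apply: sub_sigma_algebra; exists (Defs.proj i); first by exists i.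
exists c; rewrite setTI; apply/seteqP.
by split=> x /=; rewrite in_itv/= andbT.
Qed.

(** The values [None] of [e] impose no condition, so that finite or empty families of coordinates
    are covered, even when [I] is empty. *)
Definition determined_by e (A : set (I -> R)) :=
  forall v w, (forall k i, e k = Some i -> v i = w i) -> A v -> A w.

Lemma sigma_determined (A : set (I -> R)) :
  <<s rays (range (@Defs.proj R I)) >> A -> exists e, determined_by e A.
Proof.
move=> sA.
suff : <<s rays (range (@Defs.proj R I)) >> `<=` [set A | exists e, determined_by e A].
  by apply.
apply: smallest_sub => [|_ [_ [i _ <-] [c ->]]]; last first.
  by exists (fun=> Some i) => v w vw; rewrite /Defs.proj /= (vw 0%N i).
split => [|B [e eB]|F /choice[e eF]].
- by exists (fun=> None).
- exists e => v w vw [_ nBv]; split => // Bw; apply: nBv.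
  by apply: eB Bw => k i /vw.
(* Countably many sequences of coordinates are merged into one by coding pairs. *)
exists (fun n => if unpickle n is Some (m, k) then e m k else None).
move=> v w vw [m _ Fmv]; exists m => //; apply: eF Fmv => k i eki.
by apply: (vw (pickle (m, k))); rewrite pickleK.
Qed.

(** Each set [q < tau] with [q] rational depends on countably many coordinates, and these countably
    many sets together determine [tau]. *)
Lemma measurable_determined {tau} :
  measurable_fun [set: cylinder_space] tau ->
  exists e, forall v w, (forall k i, e k = Some i -> v i = w i) -> tau v = tau w.
Proof.
move=> mtau.
have /choice[e eq] : forall q : rat, exists e,
    determined_by e [set v | ratr q < tau v].
  move=> q; apply: sigma_determined.
  rewrite (_ : [set v | _] = setT `&` tau @^-1` `]ratr q, +oo[); first exact: mtau.
  by apply/seteqP; split=> v /=; rewrite in_itv/= andbT; [|case].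
exists (fun n => if unpickle n is Some (q, k) then e q k else None).
have le_tau v w : (forall n i, (if unpickle n is Some (q, k) then e q k else None)
    = Some i -> v i = w i) -> tau v <= tau w.
  move=> vw; rewrite leNgt; apply/negP => /rat_in_itvoo[q].
  rewrite in_itv/= => /andP[wq qv].
  suff /(lt_trans wq) : ratr q < tau w by rewrite ltxx.
  apply: (eq q) qv => k i eki.
  by apply: (vw (pickle (q, k))); rewrite pickleK.
move=> v w vw; apply/eqP; rewrite eq_le !le_tau// => n i ni.
by rewrite (vw n).
Qed.

Definition coord_norm (o : option I) (v : I -> R) : R :=
  if o is Some i then `|v i| else 0.

Lemma preserves_dominated {p : R} {tau} {e} : 1 <= p ->
  preserves_integrability p tau ->
  (forall v w, (forall k i, e k = Some i -> v i = w i) -> tau v = tau w) ->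
  exists N, forall v,
    `|tau v| <= (2 ^ N.+1)%:R * \sum_(k < N) coord_norm (e k) v.
Proof.
(* The single [N] governs both the constant and the number of coordinates, so its failure yields one
   sequence [V]. *)
move=> p1 ptau etau; apply: contrapT => /forallNP Ntau.
have /choice[V tauV] : forall n, exists v,
    (2 ^ n.+1)%:R * \sum_(k < n) coord_norm (e k) v < `|tau v|.
  by move=> n; have /existsNP[v /negP] := Ntau n; rewrite -ltNge; exists v.
(* Nothing controls [V n i] at coordinates missing from [e]; they are set to 0, which [tau] does not
   notice. *)
pose f i n : R := if `[< exists k, e k = Some i >] then V n i else 0.
have tauf n : tau (f ^~ n) = tau (V n).
  by apply: etau => k i eki; rewrite /f asboolT//; exists k.
have tau0 n : 0 < `|tau (V n)|.
  apply: le_lt_trans (tauV n); rewrite mulr_ge0// sumr_ge0// => k _.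
  by rewrite /coord_norm; case: (e k).
have w0 n : 0 <= (`|tau (V n)| `^ p)^-1 by rewrite invr_ge0 powR_ge0.
pose w n := NngNum (w0 n).
pose mu : {measure set nat -> \bar R} := mseries (fun n => mscale (w n) (\d_n)%R) 0.
have muL (g : nat -> R) : g \in Lfun mu p%:E <->
    (\sum_(0 <= n <oo) ((`|tau (V n)| `^ p)^-1 * `|g n| `^ p)%:E < +oo)%E.
  rewrite mem_LfunP// ge0_integral_weighted_dirac => [|n]; last exact: powR_ge0.
  by split=> [[]|].
have fL i : f i \in Lfun mu p%:E.
  apply/muL; have [[k eki]|ni] := pselect (exists k, e k = Some i); last first.
    rewrite eseries0 ?ltry// => n _ _.
    by rewrite /f asboolF// normr0 powR0 ?mulr0// gt_eqF// (lt_le_trans ltr01).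
  (* Once [n > k], the coordinate [e k] occurs in the sum violated by [V n], so
     [|V n i| <= |tau (V n)| / 2^(n+1)]. *)
  apply: (@nneseries_half_lty _ _ k.+1) => n; first by rewrite mulr_ge0// powR_ge0.
  move=> kn; rewrite /f asboolT; last by exists k.
  rewrite ler_pdivrMl ?powR_gt0//.
  have p0 : 0 <= p by exact: le_trans p1.
  have c0 : 0 <= (2 ^ n.+1)%:R^-1 :> R by rewrite invr_ge0.
  apply: (@le_trans _ _ ((`|tau (V n)| * (2 ^ n.+1)%:R^-1) `^ p)).
    apply: ge0_ler_powR; rewrite ?nnegrE ?mulr_ge0//.
    rewrite ler_pdivlMr ?ltr0n ?expn_gt0// mulrC.
    apply/ltW/le_lt_trans/(tauV n); rewrite ler_wpM2l//.
    rewrite (bigD1 (Ordinal kn))//= eki lerDl sumr_ge0// => j _.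
    by rewrite /coord_norm; case: (e j).
  rewrite powRM// ler_wpM2l ?powR_ge0//.
  (* For a base in (0,1], the exponent [p >= 1] gives at most the exponent 1. *)
  rewrite -[leRHS]powRr1//.
  apply: ger_powR => //.
  by rewrite invr_gt0 invf_le1 ?ltr0n ?expn_gt0// ler1n expn_gt0.
have : (fun n => tau (f ^~ n)) \in Lfun mu p%:E by exact: ptau fL.
(* The weights were chosen to make every term of this series equal to 1, so it diverges. *)
rewrite muL; under eq_eseriesr => n _.
  rewrite tauf mulVf; last by rewrite gt_eqF// powR_gt0.
  over.
rewrite ltey; apply/negP; rewrite negbK; apply/eqP/eq_infty => r.
have := @nneseries_lim_ge R (fun=> 1%E) xpredT 0 (Num.bound r).
move/(_ (fun _ _ _ => lee01)); apply: le_trans.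
rewrite sumEFin lee_fin big_mkord sumr_const card_ord.
have [r0|r0] := leP 0 r; first exact/ltW/archi_boundP.
exact: le_trans (ltW r0) _.
Qed.

End preserving.

Theorem theorem2p3 (R : realType) (I : Type) (p : R) (hp : 1 <= p) :
  [set tau : (I -> R) -> R | preserves_integrability p tau] =
  generated (listed_operations R) I.
Proof.
have gen_closed o : listed_operations R o ->
    closed_under (@op_fun R o) (generated (listed_operations R) I).
  move=> lo f fG S [S_closed projS]; apply: (S_closed) => // i.
  exact: (fG i) S (conj S_closed projS).
have gen_proj i : generated (listed_operations R) I (Defs.proj i).
  by move=> S [_]; apply; exists i.
apply/seteqP; split=> [tau ptau|]; last first.
  apply: smallest_sub => [op lop f pf|_ [i _ <-]]; last by move=> d T mu h; apply.
  move=> d T mu h hL.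
  (* Composing with the family [h] reduces closure of the preserving operations to closure of
     L^p. *)
  apply: (closed_Lfun hp op lop (fun k x => f k (fun i => h i x))) => k.
  exact: pf.
have mtau := preserves_measurable hp ptau.
have [e etau] := measurable_determined mtau.
have [N tauN] := preserves_dominated hp ptau etau.
apply: (@closed_measurable_dominated R (I -> measurableTypeR R) _ _ _
  gen_closed _ _ tauN).
- move=> _ B mB; have := mtau measurableT B mB; rewrite !setTI.
  (* Projections are generated, so the cylinder sigma-algebra lies in the one induced by all
     generated functions. *)
  suff: <<s rays (range (@Defs.proj R I)) >> `<=`
      <<s rays (generated (listed_operations R) I) >> by apply.
  apply: sub_sigma_algebra2 => _ [f [i _ <-] [c ->]].
  by exists (Defs.proj i) => //; exists c.
- apply: (closed_scale gen_closed); apply: (closed_sum gen_closed (fun k => coord_norm (e k))) => k.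
  rewrite /coord_norm; case: (e k) => [i|]; last exact: (closed_zero gen_closed).
  exact: (closed_abs gen_closed (gen_proj i)).
Qed.
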